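(* Let $T\ge1$, $n\ge2$, $\mu\in\mathbb{R}$, $\sigma>0$, $z^*\in\mathbb{R}$, $\tau\in\{1,\dots,T\}$. Under $\mathbf{H_0}$ the real numbers $X_{t,k}$ ($t\le T$, $k\le n$) are i.i.d. $\mathcal{N}(\mu,\sigma^2)$; under $\mathbf{H_1^\tau}$ they are generated the same way and then $X_{\tau,J}$ is replaced by $z^*$, with $J$ uniform on $\{1,\dots,n\}$ independent of the data. Let $\bar X_\tau=\frac1n\sum_{k=1}^nX_{\tau,k}$ and \[ \log\mathrm{LR}_\tau=-\frac12\log\Big(\frac{n-1}{n}\Big)-\frac{n}{2(n-1)\sigma^2}(\bar X_\tau-\mu)^2+\frac{(z^*-\mu)n}{(n-1)\sigma^2}(\bar X_\tau-\mu)-\frac{(z^*-\mu)^2}{2(n-1)\sigma^2}. \] For a threshold $\gamma\in\mathbb{R}$ let $\alpha(\gamma)=\mathbb{P}_{\mathbf{H_0}}(\log\mathrm{LR}_\tau\ge\gamma)$. Define $\gamma_{\max}=\frac12\big[\frac{(z^*-\mu)^2}{\sigma^2}-\log\big(\frac{n-1}{n}\big)\big]$, $m^*=\frac{(z^*-\mu)^2}{\sigma^2}$, $a=\sqrt{m^*n}$ and, for $\gamma\le\gamma_{\max}$, $b(\gamma)=\sqrt{(n-1)\big(m^*-\log(1-\frac1n)-2\gamma\big)}$. Then $\alpha(\gamma)=0$ for $\gamma>\gamma_{\max}$, and for $\gamma\le\gamma_{\max}$, \[ \alpha(\gamma)=\Phi(a+b(\gamma))-\Phi(a-b(\gamma)),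 \] where $\Phi$ is the standard normal cumulative distribution function.
   Context: $\alpha(\gamma)$ is the Type I error of the test that declares ''target present'' when $\log\mathrm{LR}_\tau\ge\gamma$. *)

(* Defs.v *)
From HB Require Import structures.
From mathcomp Require Import all_boot all_order all_algebra.
From mathcomp Require Import all_classical all_reals all_analysis.
Set Implicit Arguments. Unset Strict Implicit. Unset Printing Implicit Defensive.
Import Order.TTheory GRing.Theory Num.Def Num.Theory.
Import numFieldNormedType.Exports.
Local Open Scope classical_set_scope.
Local Open Scope ring_scope.

Definition mutually_independent d (Omega : measurableType d) (R : realType)
  (P : probability Omega R) (I : finType) (X : I -> {RV P >-> R}) : Prop :=
  forall B : I -> set R, (forall i, measurable (B i)) ->
    P (\bigcap_(i in [set: I]) (X i @^-1` B i)) =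
    (\prod_(i : I) P (X i @^-1` B i))%E.

(* i.i.d. N(mu, sigma^2) family (sigma = standard deviation) *)
Definition iid_normal d (Omega : measurableType d) (R : realType)
  (P : probability Omega R) (I : finType) (X : I -> {RV P >-> R})
  (mu sigma : R) : Prop :=
  mutually_independent X /\
  forall i (A : set R), measurable A -> distribution P (X i) A = normal_prob mu sigma A.

Definition Phi (R : realType) (x : R) : R := fine (normal_prob 0 1 `]-oo, x]).

Definition Xbar d (Omega : measurableType d) (R : realType)
  (P : probability Omega R) (T n : nat) (X : 'I_T * 'I_n -> {RV P >-> R})
  (tau : 'I_T) (w : Omega) : R :=
  n%:R^-1 * \sum_(k < n) X (tau, k) w.

Definition logLR d (Omega : measurableType d) (R : realType)
  (P : probability Omega R) (T n : nat) (X : 'I_T * 'I_n -> {RV P >-> R})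
  (mu sigma zstar : R) (tau : 'I_T) (w : Omega) : R :=
  let xb := Xbar X tau w in
  let n' := n%:R : R in
  - 2^-1 * ln ((n' - 1) / n')
  - n' / (2 * (n' - 1) * sigma ^+ 2) * (xb - mu) ^+ 2
  + (zstar - mu) * n' / ((n' - 1) * sigma ^+ 2) * (xb - mu)
  - (zstar - mu) ^+ 2 / (2 * (n' - 1) * sigma ^+ 2).

Definition alpha d (Omega : measurableType d) (R : realType)
  (P : probability Omega R) (T n : nat) (X : 'I_T * 'I_n -> {RV P >-> R})
  (mu sigma zstar : R) (tau : 'I_T) (gamma : R) : \bar R :=
  P [set w | gamma <= logLR X mu sigma zstar tau w].

Definition gamma_max (R : realType) (n : nat) (mu sigma zstar : R) : R :=
  2^-1 * ((zstar - mu) ^+ 2 / sigma ^+ 2 - ln ((n%:R - 1) / n%:R)).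

Definition mstar (R : realType) (mu sigma zstar : R) : R :=
  (zstar - mu) ^+ 2 / sigma ^+ 2.

Definition a_coef (R : realType) (n : nat) (mu sigma zstar : R) : R :=
  Num.sqrt (mstar mu sigma zstar * n%:R).

Definition b_coef (R : realType) (n : nat) (mu sigma zstar gamma : R) : R :=
  Num.sqrt ((n%:R - 1) * (mstar mu sigma zstar - ln (1 - n%:R^-1) - 2 * gamma)).

(* Main.v *)
Require Import Defs.
From HB Require Import structures.
From mathcomp Require Import all_boot all_order all_algebra.
From mathcomp Require Import all_classical all_reals all_analysis.
From mathcomp Require Import measurable_realfun ring lra.
Import Order.TTheory GRing.Theory Num.Def Num.Theory.
Local Open Scope classical_set_scope.
Local Open Scope ring_scope.

(* Completing the square, logLR = gamma_max - (Z - z)^2 / (2 (n - 1)), where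
   Z = sqrt n (Xbar - mu) / sigma and z = sqrt n (zstar - mu) / sigma. Hence the
   test rejects iff |Z - z| <= b(gamma). A sum of independent normal variables
   is normal (the convolution of two Gaussian densities is computed by Tonelli
   and completing the square), so Z is standard normal; as |z| = a, the symmetry
   of the standard normal law allows z to be replaced by a. *)

(** * Affine changes of variable for Lebesgue measure *)

Section affine_change_of_variables.
Context {R : realType}.
Local Notation leb := (@lebesgue_measure R).

Lemma measurable_affine (s m : R) :
  measurable_fun [set: R] (fun x : R => s * x + m).
Proof. by apply: measurable_funD => //; exact: measurable_funM. Qed.

(** By uniqueness of Lebesgue measure: the pushforward of [|s|] times Lebesgue measure gives every
    half-open interval its length. *)
Lemma lebesgue_measure_affine (s m : R) (A : set R) : s != 0 -> measurable A ->
  leb A = (`|s|%:E * leb ((fun x => (s * x + m)%R) @^-1` A))%E.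
Proof.
move=> s0 mA.
pose f : measurableTypeR R -> measurableTypeR R := fun x => s * x + m.
rewrite -[RHS]/(pushforward (mscale (NngNum (normr_ge0 s)) leb) f A).
apply: lebesgue_measure_unique => //; first exact: measurable_affine.
move=> _ _ [[a b]] /= _ <-; rewrite /pushforward/= /mscale/=.
have [s_gt0|s_lt0|/eqP] := ltgtP 0 s; last by rewrite eq_sym (negbTE s0).
- rewrite (_ : f @^-1` _ = `](a - m) / s, (b - m) / s]%classic); last first.
    apply/seteqP; split => x /=; rewrite !in_itv/= /f ltr_pdivrMr// ler_pdivlMr//;
    by rewrite ltrBlDr lerBrDr [x * _]mulrC.
  rewrite !lebesgue_measure_itv/= !lte_fin ltr_pM2r ?invr_gt0// ltrD2r.
  case: ifPn => _; last by rewrite mule0.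
  by rewrite !EFinN -!EFinD -EFinM gtr0_norm//; congr EFin; field.
(* A negative slope reverses the interval, so the closed end moves to the left; the length is
   unaffected. *)
- rewrite (_ : f @^-1` _ = `[(b - m) / s, (a - m) / s[%classic); last first.
    apply/seteqP; split => x /=; rewrite !in_itv/= /f ltr_ndivlMr// ler_ndivrMr//;
    by rewrite ltrBlDr lerBrDr [x * _]mulrC andbC.
  rewrite !lebesgue_measure_itv/= !lte_fin ltr_nM2r ?invr_lt0// ltrD2r.
  case: ifPn => _; last by rewrite mule0.
  by rewrite !EFinN -!EFinD -EFinM ltr0_norm//; congr EFin; field.
Qed.

Lemma ge0_integral_affine (s m : R) (A : set R) (f : R -> \bar R) : s != 0 ->
    measurable A -> measurable_fun A f -> (forall x, (0 <= f x)%E) ->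
  (\int[leb]_(x in A) f x =
   `|s|%:E * \int[leb]_(x in (fun x => (s * x + m)%R) @^-1` A) f (s * x + m)%R)%E.
Proof.
move=> s0 mA mf f0.
pose g : measurableTypeR R -> measurableTypeR R := fun x => s * x + m.
have mg : measurable_fun setT g := measurable_affine s m.
rewrite -(ge0_integral_mscale leb _ (NngNum (normr_ge0 s)))//; last 2 first.
- by rewrite -[X in measurable X]setTI; exact: mg.
- by apply: (measurable_comp mA _ mf); [move=> _ [x Ax <-]|exact: measurable_funTS mg].
rewrite -(ge0_integral_pushforward mg (mscale (NngNum (normr_ge0 s)) leb))//.
by apply: eq_measure_integral => B mB _; exact: lebesgue_measure_affine.
Qed.

End affine_change_of_variables.

(** * Affine images and symmetry of normal laws *)

Section normal_affine.
Context {R : realType}.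
Local Notation leb := (@lebesgue_measure R).

Lemma normal_prob_affine (m s : R) (A : set R) : s != 0 -> measurable A ->
  normal_prob m s A = normal_prob 0 1 ((fun x => s * x + m) @^-1` A).
Proof.
move=> s0 mA; rewrite /normal_prob.
have mpdf (B : set R) m' s' :
    measurable_fun B (fun x => (@normal_pdf R m' s' x)%:E).
  by apply/measurable_funTS/measurable_EFinP; exact: measurable_normal_pdf.
rewrite (ge0_integral_affine s m)//; last first.
  by move=> x; rewrite lee_fin normal_pdf_ge0.
rewrite -ge0_integralZl//=; last 3 first.
- rewrite -[X in measurable X]setTI; exact: measurable_affine.
- apply/measurable_funTS/measurable_EFinP.
  exact: (measurableT_comp (measurable_normal_pdf _ _) (measurable_affine _ _)).
- by move=> x _; rewrite lee_fin normal_pdf_ge0.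
apply: eq_integral => x _; rewrite -EFinM; congr EFin.
(* The Jacobian [|s|] cancels the square root of [s ^+ 2] in the peak; the exponents are compared
   afterwards. *)
rewrite !normal_pdfE ?oner_eq0// mulrA; congr (_ * _).
  rewrite /normal_peak expr1n mul1r -mulrnAr sqrtrM ?sqr_ge0// sqrtr_sqr.
  by rewrite invfM mulVKf// normr_eq0.
by rewrite /normal_fun; congr expR; rewrite expr1n addrK subr0 exprMn; field.
Qed.

(** The density sees the standard deviation only through its square, so the parameter -1 gives the
    standard law again, while [normal_prob_affine] with slope -1 gives its reflection. *)
Lemma normal_prob_opp (A : set R) : measurable A ->
  normal_prob 0 1 (-%R @^-1` A) = normal_prob 0 1 A :> \bar R.
Proof.
move=> mA; rewrite -[RHS](_ : normal_prob 0 (-1) A = _).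
  rewrite [RHS]normal_prob_affine ?oppr_eq0 ?oner_eq0//; congr (_ _).
  by apply/funext => x /=; rewrite mulN1r addr0.
rewrite /normal_prob /normal_pdf oppr_eq0 oner_eq0.
by rewrite /normal_peak /normal_fun sqrrN.
Qed.

End normal_affine.

(** * Convolution of two normal laws *)

Section normal_convolution.
Context {R : realType}.
Local Notation leb := (@lebesgue_measure R).

(** The Radon-Nikodym derivative and [normal_pdf] have the same integral over every measurable set,
    hence agree almost everywhere. *)
Lemma ge0_integral_normal_prob (m s : R) (f : R -> \bar R) :
    measurable_fun [set: R] f -> (forall x, (0 <= f x)%E) ->
  (\int[normal_prob m s]_x f x = \int[leb]_x (f x * (normal_pdf m s x)%:E))%E.
Proof.
move=> mf f0; have dom := normal_prob_dominates m s.
rewrite -(Radon_Nikodym_SigmaFinite.change_of_variables dom)//=.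
have intd := Radon_Nikodym_SigmaFinite.f_integrable dom.
have mpdf : measurable_fun [set: R] (fun x => (normal_pdf m s x)%:E).
  by apply/measurable_EFinP; exact: measurable_normal_pdf.
apply: ae_eq_integral => //.
- by apply: emeasurable_funM => //; exact: measurable_int intd.
- exact: emeasurable_funM.
apply: ae_eqe_mul2l; apply: integral_ae_eq => //= E _ mE.
by rewrite -Radon_Nikodym_SigmaFinite.f_integral.
Qed.

(** Completing the square in [x] factors the joint density into the density of the sum at [y] and
    the conditional density of the first summand given that sum. *)
Lemma normal_pdfM (m1 m2 s1 s2 x y : R) : s1 != 0 -> s2 != 0 ->
  let v := s1 ^+ 2 + s2 ^+ 2 in
  normal_pdf m1 s1 x * normal_pdf m2 s2 (y - x) =
  normal_pdf (m1 + m2) (Num.sqrt v) y *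
  normal_pdf ((m1 * s2 ^+ 2 + (y - m2) * s1 ^+ 2) / v) (s1 * s2 / Num.sqrt v) x.
Proof.
move=> s10 s20 v.
have v0 : 0 < v by rewrite addr_gt0// exprn_even_gt0.
have sv0 : Num.sqrt v != 0 by rewrite gt_eqF// sqrtr_gt0.
have vE : Num.sqrt v ^+ 2 = v by rewrite sqr_sqrtr// ltW.
rewrite !normal_pdfE//; last by rewrite !mulf_neq0// invr_neq0.
rewrite mulrACA [RHS]mulrACA; congr (_ * _).
  have peak0 (s : R) : 0 <= s ^+ 2 * pi *+ 2.
    by rewrite mulrn_wge0// mulr_ge0 ?sqr_ge0 ?pi_ge0.
  rewrite /normal_peak -[LHS]invfM -[RHS]invfM; congr _^-1.
  rewrite -[LHS]sqrtrM// -[RHS]sqrtrM//; congr Num.sqrt; rewrite vE !exprMn exprVn vE.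
  by field; rewrite gt_eqF.
rewrite /normal_fun -!expRD; congr expR; rewrite !exprMn exprVn vE.
rewrite /v in v0 *; field.
by rewrite s10 s20 gt_eqF.
Qed.

Lemma normal_prob_convolution (m1 m2 s1 s2 : R) (A : set R) :
    s1 != 0 -> s2 != 0 -> measurable A ->
  (\int[normal_prob m1 s1]_x normal_prob m2 s2 ((fun y => (x + y)%R) @^-1` A) =
   normal_prob (m1 + m2) (Num.sqrt (s1 ^+ 2 + s2 ^+ 2)) A)%E.
Proof.
move=> s10 s20 mA.
(* Here [z.1] is the first summand and [z.2] the sum; after the shift, the constraint [A] bears on
   [z.2] alone. *)
pose h (z : R * R) : \bar R :=
  ((normal_pdf m2 s2 (z.2 - z.1) * \1_A z.2)%:E)%E.
have mh : measurable_fun [set: R * R] h.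
  apply/measurable_EFinP; apply: measurable_funM; last first.
    have mi : measurable_fun [set: R] (\1_A : R -> R) by exact: measurable_indic.
    exact: (measurableT_comp mi measurable_snd).
  apply: (measurableT_comp (measurable_normal_pdf _ _)).
  exact: measurable_funB.
have h0 z : (0 <= h z)%E by rewrite lee_fin mulr_ge0 ?normal_pdf_ge0// indicE.
have shiftE x : normal_prob m2 s2 ((fun y => x + y) @^-1` A) =
    (\int[leb]_y h (x, y))%E.
  rewrite /normal_prob (ge0_integral_affine 1 (- x)) ?oner_eq0//; last 3 first.
  - rewrite -[X in measurable X]setTI; exact: measurable_funD.
  - by apply/measurable_funTS/measurable_EFinP; exact: measurable_normal_pdf.
  - by move=> y; rewrite lee_fin normal_pdf_ge0.
  rewrite normr1 mul1e (_ : _ @^-1` _ = A); last first.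
    by apply/seteqP; split => y /=; rewrite mul1r addrC subrK.
  rewrite integral_mkcond; apply: eq_integral => y _.
  rewrite /h patchE indicE /= mul1r; case: ifPn => yA; first by rewrite mulr1.
  by rewrite mulr0.
under eq_integral do rewrite shiftE.
rewrite ge0_integral_normal_prob//; last 2 first.
- exact: measurable_fun_fubini_tonelli_F.
- by move=> x; exact: integral_ge0.
pose g (z : R * R) : \bar R := (h z * (normal_pdf m1 s1 z.1)%:E)%E.
have mg : measurable_fun [set: R * R] g.
  apply: emeasurable_funM => //; apply/measurable_EFinP.
  exact: (measurableT_comp (measurable_normal_pdf _ _)).
have g0 z : (0 <= g z)%E by rewrite mule_ge0// lee_fin normal_pdf_ge0.
transitivity (\int[leb]_x \int[leb]_y g (x, y))%E.
  apply: eq_integral => x _; rewrite -ge0_integralZr//.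
  - exact: (measurableT_comp mh).
  - by rewrite lee_fin normal_pdf_ge0.
(* With [y] fixed, integrating over [x] first leaves a conditional density of total mass 1. *)
rewrite (@fubini_tonelli _ _ _ _ _ leb leb g mg g0) /normal_prob [RHS]integral_mkcond.
apply: eq_integral => y _; rewrite patchE.
rewrite /g/h/=; case: ifPn => yA; last first.
  by apply: integral0_eq => x _; rewrite indicE (negbTE yA) mulr0 mul0e.
under eq_integral => x _ do
  rewrite indicE yA mulr1 muleC -EFinM normal_pdfM// EFinM.
rewrite ge0_integralZl//=; last 3 first.
- by apply/measurable_EFinP; exact: measurable_normal_pdf.
- by move=> x _; rewrite lee_fin normal_pdf_ge0.
- by rewrite lee_fin normal_pdf_ge0.
by rewrite integral_normal_pdf mule1.
Qed.

End normal_convolution.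

(** * Sums of independent normal variables *)

Section sum_of_independent_normals.
Context {R : realType} {d : measure_display} {Omega : measurableType d}.

(** The values on rectangles determine the joint law of [U] and [V]. The factor [c] is there so that
    [Q] can be a probability restricted to an event. *)
Lemma measure_preimage_add (Q : {measure set Omega -> \bar R})
    (U V : Omega -> R) (N1 N2 : probability (measurableTypeR R) R) (c : R) (A : set R) :
    measurable_fun setT U -> measurable_fun setT V -> 0 <= c ->
    (forall A1 A2, measurable A1 -> measurable A2 ->
      Q (U @^-1` A1 `&` V @^-1` A2) = c%:E * (N1 A1 * N2 A2))%E ->
    measurable A ->
  Q ((fun w => U w + V w) @^-1` A) =
  (c%:E * \int[N1]_x N2 ((fun y => (x + y)%R) @^-1` A))%E.
Proof.
move=> mU mV c0 QE mA.
pose RR : measurableType _ := (measurableTypeR R * measurableTypeR R)%type.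
pose uv : Omega -> RR := fun w => (U w, V w).
have muv : measurable_fun setT uv.
  exact: measurable_fun_pair.
(* The factor [c] goes to the first marginal, packed as a finite measure for the uniqueness of
   product measures. *)
pose M : set (measurableTypeR R) -> \bar R := mscale (NngNum c0) N1.
have finM : fin_num_fun M.
  by move=> B mB; rewrite /M/= /mscale/= fin_numM// fin_num_measure.
pose FM : {finite_measure set (measurableTypeR R) -> \bar R} :=
  HB.pack M (Measure.on (mscale (NngNum c0) N1))
    (Measure_isFinite.Build _ _ _ M finM).
pose C : set RR := (fun z => z.1 + z.2) @^-1` A.
have mC : measurable C.
  by rewrite -[C]setTI; exact: measurable_funD.
transitivity ((FM \x N2)%E C).
  rewrite -[LHS]/(pushforward Q uv C).
  apply/esym/product_measure_unique => // A1 A2 mA1 mA2 /=.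
  by rewrite /mscale/= -muleA -QE.
rewrite /product_measure1 ge0_integral_mscale//=; last first.
  exact: (measurable_fun_xsection N2 mC).
congr (_ * _)%E; apply: eq_integral => x _ /=; congr (N2 _).
by apply/seteqP; split => y; rewrite /xsection/C/= inE.
Qed.

Variables (P : probability Omega R) (I : finType) (X : I -> {RV P >-> R}).
Variables (mu sigma : R).
Hypotheses (sigma_gt0 : 0 < sigma) (iidX : iid_normal X mu sigma).

Lemma measurable_bigcap_preimage (D : set I) (B : I -> set R) :
  (forall i, measurable (B i)) ->
  measurable (\bigcap_(i in D) (X i @^-1` B i)).
Proof.
move=> mB; apply: fin_bigcap_measurable => [|i _]; first exact: finite_finset.
by rewrite -[X in measurable X]setTI; exact: measurable_funP.
Qed.

(* The events on the variables outside the sum make the induction go through: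
   they are what provides the independence of the next summand. *)
Lemma iid_normal_sum_joint (i0 : I) (r : seq I) (A : set R) (B : I -> set R) :
    uniq (i0 :: r) -> measurable A -> (forall i, measurable (B i)) ->
  P ((fun w => \sum_(i <- i0 :: r) X i w) @^-1` A `&`
     \bigcap_(i in [set i | i \notin i0 :: r]) (X i @^-1` B i)) =
  (normal_prob ((size r).+1%:R * mu) (Num.sqrt (size r).+1%:R * sigma) A *
   \prod_(i | i \notin i0 :: r) P (X i @^-1` B i))%E.
Proof.
have [indepX distrX] := iidX.
elim: r i0 A B => [|i1 r IH] i0 A B uniq_r mA mB.
  (* Putting [A] at [i0] turns the event into a full product event, to which mutual independence
     applies. *)
  pose B' i := if i == i0 then A else B i.
  have mB' i : measurable (B' i) by rewrite /B'; case: ifP.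
  transitivity (P (\bigcap_(i in [set: I]) (X i @^-1` B' i))).
    congr (P _); apply/seteqP; split => w /=.
      rewrite big_seq1 => -[Aw Bw] i _ /=; rewrite /B'.
      by case: eqVneq => [->//|ii0]; apply: Bw; rewrite /= inE.
    move=> Bw; split; first by have /= := Bw i0 Logic.I; rewrite /B' eqxx big_seq1.
    move=> i /=; rewrite inE => ii0; have /= := Bw i Logic.I.
    by rewrite /B' (negbTE ii0).
  rewrite indepX// (bigD1 i0)//= {1}/B' eqxx mul1r sqrtr1 mul1r.
  congr (_ * _)%E; first exact: distrX.
  by apply: eq_big => i; rewrite ?inE// /B' => /negbTE ->.
have /andP[i0_notin uniq_r1] := uniq_r.
pose s := i1 :: r.
set E := \bigcap_(i in _) _.
have mE : measurable E by exact: measurable_bigcap_preimage.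
pose U w := \sum_(i <- s) X i w.
have mU : measurable_fun setT U by exact: measurable_sum.
pose c := (\prod_(i | i \notin i0 :: s) P (X i @^-1` B i))%E.
have c0 : (0 <= c)%E by apply: prode_ge0.
have cfin : c \is a fin_num.
  apply: prode_fin_num => i _; apply: fin_num_measure.
  by rewrite -[X in measurable X]setTI; exact: measurable_funP.
pose N : probability _ _ := normal_prob ((size r).+1%:R * mu) (Num.sqrt (size r).+1%:R * sigma).
(* Under [P] restricted to [E], the pair [U], [X i0] factors up to [c], the product of the
   probabilities of the outside events. *)
have QE A1 A2 : measurable A1 -> measurable A2 ->
    mrestr P mE (U @^-1` A1 `&` X i0 @^-1` A2) =
    ((fine c)%:E * (N A1 * normal_prob mu sigma A2))%E.
  move=> mA1 mA2; rewrite fineK// /mrestr -(distrX i0)//.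
  (* Seen from the shorter list [s], [X i0] is an outside variable; assigning it [A2] makes the
     induction hypothesis applicable. *)
  pose B' i := if i == i0 then A2 else B i.
  have mB' i : measurable (B' i) by rewrite /B'; case: ifP.
  have B'i0 : B' i0 = A2 by rewrite /B' eqxx.
  transitivity (P (U @^-1` A1 `&`
      \bigcap_(i in [set i | i \notin s]) (X i @^-1` B' i))).
    congr (P _); apply/seteqP; split => w /=.
      move=> [[A1w A2w] Ew]; split => // i /= i_notin; rewrite /B'.
      by case: eqVneq => [->//|ii0]; apply: Ew; rewrite /= inE negb_or ii0.
    move=> [A1w Ew]; split; first by split => //; rewrite -B'i0; exact: Ew.
    move=> i /=; rewrite inE negb_or => /andP[ii0 i_notin].
    by have /= := Ew i i_notin; rewrite /B' (negbTE ii0).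
  rewrite IH// (bigD1 i0)//= B'i0 [RHS]muleC -muleA; congr (_ * (_ * _))%E.
  apply: eq_big => i; first by rewrite [in RHS]inE negb_or andbC.
  by move=> /andP[_ /negbTE ii0]; rewrite /B' ii0.
have := measure_preimage_add (mrestr P mE) U (X i0) N (normal_prob mu sigma)
  (fine c) A mU (measurable_funP (X i0)) (fine_ge0 c0) QE mA.
rewrite normal_prob_convolution ?gt_eqF ?mulr_gt0 ?sqrtr_gt0 ?ltr0n// fineK// muleC.
have -> : (size r).+1%:R * mu + mu = (size r).+2%:R * mu.
  by rewrite -[(size r).+2%:R]natr1 mulrDl mul1r.
have -> : Num.sqrt ((Num.sqrt (size r).+1%:R * sigma) ^+ 2 + sigma ^+ 2) =
    Num.sqrt (size r).+2%:R * sigma.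
  rewrite exprMn sqr_sqrtr ?ler0n// -[X in _ + X]mul1r -mulrDl natr1.
  by rewrite sqrtrM ?ler0n// sqrtr_sqr gtr0_norm.
move=> <-; rewrite /mrestr; congr (P (_ `&` _)).
by apply/seteqP; split => w /=; rewrite big_cons addrC.
Qed.

(** The joint statement with every outside event certain. *)
Lemma iid_normal_sum (r : seq I) (A : set R) :
    uniq r -> (0 < size r)%N -> measurable A ->
  P ((fun w => \sum_(i <- r) X i w) @^-1` A) =
  normal_prob ((size r)%:R * mu) (Num.sqrt (size r)%:R * sigma) A.
Proof.
case: r => // i0 r uniq_r _ mA.
have := iid_normal_sum_joint i0 r A (fun=> setT) uniq_r mA (fun=> measurableT).
rewrite (_ : \bigcap_(i in _) _ = setT); last first.
  by rewrite -subTset => w _ i _.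
rewrite setIT big1 ?mule1// => i _.
by rewrite preimage_setT probability_setT.
Qed.

End sum_of_independent_normals.

(** * Interval probabilities through [Phi] *)

Section standard_normal_cdf.
Context {R : realType}.

(** A difference of values of [Phi] is the mass of a half-open interval; the endpoint [x] adds
    nothing since the law has a density. *)
Lemma normal_prob_itvcc (x y : R) : x <= y ->
  normal_prob 0 1 `[x, y] = (Phi y - Phi x)%:E.
Proof.
move=> xy.
have -> : normal_prob 0 1 `[x, y] = normal_prob 0 1 `]x, y] :> \bar R.
  rewrite /normal_prob [RHS]integral_itv_obnd_cbnd//.
  by apply: measurable_funTS; apply/measurable_EFinP; exact: measurable_normal_pdf.
have fin z : normal_prob 0 1 `]-oo, z] \is a @fin_num R.
  exact: fin_num_measure.
rewrite EFinB /Phi !fineK// (@itv_bndbnd_setU _ _ -oo%O (BRight x) (BRight y))//.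
rewrite measureU//=; last first.
  apply/seteqP; split => z //=; rewrite !in_itv/= => -[zx /andP[xz _]].
  by move: (lt_le_trans xz zx); rewrite ltxx.
by rewrite [X in (X - _)%E]addeC addeK.
Qed.

End standard_normal_cdf.

(** * The standardized sample mean and the likelihood ratio *)

Section sample_mean.
Context {R : realType} {d : measure_display} {Omega : measurableType d}.
Variables (P : probability Omega R) (T n : nat) (n_gt1 : (1 < n)%N).
Variables (mu sigma zstar : R) (sigma_gt0 : 0 < sigma) (tau : 'I_T).
Variables (X : 'I_T * 'I_n -> {RV P >-> R}).

Definition zscore (x : R) : R := Num.sqrt n%:R * (x - mu) / sigma.

Lemma zscore_Xbar_law (A : set R) : iid_normal X mu sigma -> measurable A ->
  P ((fun w => zscore (Xbar X tau w)) @^-1` A) = normal_prob 0 1 A.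
Proof.
move=> iidX mA.
have n_gt0 : 0 < n%:R :> R by rewrite ltr0n ltnW.
have sn_gt0 : 0 < Num.sqrt n%:R :> R by rewrite sqrtr_gt0.
(* [f] standardizes the row sum; it inverts the affine map that carries the standard law to the law
   of that sum. *)
pose f (x : R) := zscore (n%:R^-1 * x).
have mfA : measurable (f @^-1` A).
  rewrite -[X in measurable X]setTI.
  by apply: measurable_funM => //; apply: measurable_funM => //;
     apply: measurable_funB => //; exact: measurable_funM.
pose r := [seq (tau, k) | k <- enum 'I_n].
have rn : size r = n by rewrite size_map size_enum_ord.
have := iid_normal_sum P _ X mu sigma sigma_gt0 iidX r (f @^-1` A).
rewrite rn map_inj_uniq ?enum_uniq; last by move=> i j [].
move=> /(_ isT (ltnW n_gt1) mfA).
rewrite (normal_prob_affine (n%:R * mu)) ?gt_eqF ?mulr_gt0//.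
rewrite (_ : _ @^-1` (f @^-1` A) = A); last first.
  have nE : Num.sqrt n%:R ^+ 2 = n%:R :> R by rewrite sqr_sqrtr// ltW.
  suff fK (x : R) : f (Num.sqrt n%:R * sigma * x + n%:R * mu) = x.
    by apply/seteqP; split => x /=; rewrite fK.
  rewrite /f /zscore; move: (Num.sqrt _) sn_gt0 nE => s s_gt0 <-; field.
  by rewrite !gt_eqF.
move=> <-; congr (P _); apply/seteqP; split => w /=;
by rewrite /f /Xbar big_map big_enum.
Qed.

Lemma logLR_zscore (w : Omega) :
  logLR X mu sigma zstar tau w = gamma_max n mu sigma zstar -
    (zscore (Xbar X tau w) - zscore zstar) ^+ 2 / (2 * (n%:R - 1)).
Proof.
have n1 : n%:R - 1 != 0 :> R by rewrite gt_eqF// subr_gt0 ltr1n.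
rewrite /logLR /gamma_max /zscore -mulrBl -mulrBr !exprMn sqr_sqrtr ?ler0n//.
by field; rewrite n1 gt_eqF.
Qed.

Lemma a_coef_zscore : a_coef n mu sigma zstar = `|zscore zstar|.
Proof.
rewrite /a_coef /mstar /zscore -expr_div_n sqrtrM ?sqr_ge0// sqrtr_sqr.
by rewrite mulrC -mulrA [RHS]normrM (ger0_norm (sqrtr_ge0 _)).
Qed.

(** The bound on [gamma] makes the radicand nonnegative; a negative one would be sent to 0 by
    [Num.sqrt]. *)
Lemma sqr_b_coef (gamma : R) : gamma <= gamma_max n mu sigma zstar ->
  b_coef n mu sigma zstar gamma ^+ 2 =
  2 * (n%:R - 1) * (gamma_max n mu sigma zstar - gamma).
Proof.
move=> le_gamma.
have n_gt0 : 0 < n%:R :> R by rewrite ltr0n ltnW.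
have n1 : 0 <= n%:R - 1 :> R by rewrite subr_ge0 ler1n ltnW.
have lnE : ln ((n%:R - 1) / n%:R) = ln (1 - n%:R^-1) :> R.
  by congr ln; field; rewrite gt_eqF.
have -> : 2 * (n%:R - 1) * (gamma_max n mu sigma zstar - gamma) =
    (n%:R - 1) * (mstar mu sigma zstar - ln (1 - n%:R^-1) - 2 * gamma).
  by rewrite /gamma_max /mstar lnE; field; rewrite gt_eqF.
rewrite sqr_sqrtr// mulr_ge0//.
move: le_gamma; rewrite /gamma_max -/(mstar _ _ _) lnE; lra.
Qed.

End sample_mean.

Theorem lemma3p5 (R : realType) (d : measure_display) (Omega : measurableType d)
  (P : probability Omega R) (T n : nat) (hT : (1 <= T)%N) (hn : (2 <= n)%N)
  (mu sigma zstar : R) (hsigma : 0 < sigma) (tau : 'I_T)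
  (X : 'I_T * 'I_n -> {RV P >-> R})
  (H0 : iid_normal X mu sigma) :
  (forall gamma : R, gamma_max n mu sigma zstar < gamma ->
     alpha X mu sigma zstar tau gamma = 0%E) /\
  (forall gamma : R, gamma <= gamma_max n mu sigma zstar ->
     alpha X mu sigma zstar tau gamma =
       (Phi (a_coef n mu sigma zstar + b_coef n mu sigma zstar gamma)
        - Phi (a_coef n mu sigma zstar - b_coef n mu sigma zstar gamma))%:E).
Proof.
have n1 : 0 < n%:R - 1 :> R by rewrite subr_gt0 ltr1n.
split=> gamma hgamma.
  rewrite /alpha (_ : [set w | _] = set0) ?measure0//.
  apply/seteqP; split => w //=; rewrite logLR_zscore// leNgt => /negP; apply.
  apply: le_lt_trans hgamma; rewrite gerBl.
  by rewrite divr_ge0 ?sqr_ge0// mulr_ge0// ltW.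
set a := a_coef _ _ _ _; set b := b_coef _ _ _ _ _.
have b0 : 0 <= b by exact: sqrtr_ge0.
pose z := zscore n mu sigma zstar.
have -> : alpha X mu sigma zstar tau gamma = normal_prob 0 1 `[z - b, z + b].
  rewrite -(zscore_Xbar_law P T n hn mu sigma hsigma tau X)//.
  suff LRE w : (gamma <= logLR X mu sigma zstar tau w) =
      (zscore n mu sigma (Xbar X tau w) \in `[z - b, z + b]).
    by congr (P _); apply/seteqP; split => w /=; rewrite LRE.
  (* Membership becomes a bound by [b] on a distance, and both sides being nonnegative, it may be
     squared. *)
  rewrite logLR_zscore// in_itv/= -ler_distlC lerBrDr -lerBrDl.
  rewrite ler_pdivrMr ?mulr_gt0// [_ * (2 * _)]mulrC -sqr_b_coef// -/b.
  by rewrite -[RHS]ler_sqr ?nnegrE// real_normK ?num_real// -sqrrN opprB.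
rewrite -normal_prob_itvcc; last by rewrite lerD2l ge0_cp.
(* For negative [z], [a] is [- z], and reflection exchanges the intervals of radius [b] around [z]
   and [a]. *)
have [z0|z0] := leP 0 z; first by rewrite /a a_coef_zscore// ger0_norm.
rewrite /a a_coef_zscore// ltr0_norm// -/z -normal_prob_opp//; congr (_ _).
apply/seteqP; split => x /=; rewrite !in_itv/= => /andP[? ?]; apply/andP; split; lra.
Qed.
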